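(* Let $X$ be a set with $|X|>1$ and let $*$ be an associative product on the free non-unital associative algebra $(K\langle X\rangle^+,\cdot)$. Then the following are equivalent: (i) $*$ is $(12)$-matching with $\cdot$; (ii) $*$ is interchangeable with $\cdot$; (iii) $*$ is totally compatible with $\cdot$; (iv) $*$ is determined by some $\varphi\in\Gamma(K\langle X\rangle^+)$, i.e. $a*b=\varphi(a\cdot b)$ for all $a,b\in K\langle X\rangle^+$.
   Context: All algebras and vector spaces are over a field $K$ and all products are binary and bilinear. $K\langle X\rangle^+$ is the free non-unital associative $K$-algebra over $X$, i.e. the semigroup $K$-algebra of the free semigroup $X^+$ of non-empty words over $X$ under concatenation. For an associative algebra $(A,\cdot)$ and an associative product $*$ on $A$: - $*$ is $(12)$-matching with $\cdot$ if $(a*b)\cdot c=a\cdot(b*c)$ and $(a\cdot b)*c=a*(b\cdot c)$ for all $a,b,c\in A$; - $*$ is interchangeable with $\cdot$ if $(a*b)\cdot c=(a\cdot b)*c$ and $a*(b\cdot c)=a\cdot(b*c)$ for all $a,b,c\in A$; - $*$ is totally compatible with $\cdot$ if $(a*b)\cdot c=(a\cdot b)*c=a*(b\cdot c)=a\cdot(b*c)$ for all $a,b,c\in A$. The centroid $\Gamma(A)$ is the space of linear maps $\varphi:A\to A$ with $x\cdot\varphi(y)=\varphi(x\cdot y)=\varphi(x)\cdot y$ for all $x,y\in A$. *)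

(* Defs.v *)
From HB Require Import structures.
From mathcomp Require Import all_boot all_algebra.
From mathcomp Require Import finmap monalg.

Set Implicit Arguments.
Unset Strict Implicit.
Unset Printing Implicit Defensive.

Import GRing.Theory.
Local Open Scope ring_scope.

Section FreeSemigroup.
Context (X : choiceType).

Record word : predArgType := Word { word_val :> seq X; _ : word_val != [::] }.

HB.instance Definition _ := [isSub of word for word_val].
HB.instance Definition _ := [Choice of word by <:].

Fact cat_word_subproof (u v : word) : (u : seq X) ++ v != [::].
Proof. by case: u => -[]. Qed.

Definition cat_word (u v : word) : word := Word (cat_word_subproof u v).

Fact cat_wordA : associative cat_word.
Proof. by move=> u v w; apply: val_inj; rewrite /= catA. Qed.

HB.instance Definition _ := isSemigroup.Build word cat_wordA.

End FreeSemigroup.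

Section SemigroupAlgebra.
Context (K : fieldType) (S : semigroupType).
Implicit Types (a b c : {malg K[S]}) (u v : S).

(* The same formula as [fgmul] of [monalg], which however requires the basis
   to be a monoid, i.e., to have a unit. *)
Definition sgmul a b : {malg K[S]} :=
  \sum_(u <- msupp a) \sum_(v <- msupp b) << a@_u * b@_v *g (u * v)%g >>.

Lemma sgmulEw (d1 d2 : {fset S}) a b :
    (msupp a `<=` d1)%fset -> (msupp b `<=` d2)%fset ->
  sgmul a b = \sum_(u <- d1) \sum_(v <- d2) << a@_u * b@_v *g (u * v)%g >>.
Proof.
move=> le_d1 le_d2; rewrite /sgmul (big_fset_incl _ le_d1) /=.
  apply/eq_bigr => u _; apply/big_fset_incl => // v _ /mcoeff_outdom ->.
  by rewrite mulr0 monalgU0.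
move=> u _ /mcoeff_outdom au.
by rewrite big1 // => v _; rewrite au mul0r monalgU0.
Qed.

Lemma sgmulUU x y u v :
  sgmul << x *g u >> << y *g v >> = << x * y *g (u * v)%g >>.
Proof. by rewrite (sgmulEw msuppU_le msuppU_le) !big_seq_fset1 !mcoeffUU. Qed.

Fact sgmul_linearl b : linear (sgmul^~ b).
Proof.
move=> k a a'; pose d := (msupp a `|` msupp a' `|` msupp (k *: a + a'))%fset.
have le1 : (msupp a `<=` d)%fset.
  by rewrite /d -fsetUA fsubsetUl.
have le2 : (msupp a' `<=` d)%fset.
  by rewrite /d [X in (X `|` _)%fset]fsetUC -fsetUA fsubsetUl.
have le3 : (msupp (k *: a + a') `<=` d)%fset by rewrite /d fsubsetUr.
rewrite (sgmulEw le1 (fsubset_refl _)) (sgmulEw le2 (fsubset_refl _)).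
rewrite (sgmulEw le3 (fsubset_refl _)) scaler_sumr -big_split /=.
apply/eq_bigr => u _; rewrite scaler_sumr -big_split /=.
apply/eq_bigr => v _; apply/malgP => w.
by rewrite !(mcoeffD, mcoeffZ, mcoeffU) mulrDl mulrnDl -mulrA mulrnAr.
Qed.

Fact sgmul_linearr a : linear (sgmul a).
Proof.
move=> k b b'; pose d := (msupp b `|` msupp b' `|` msupp (k *: b + b'))%fset.
have le1 : (msupp b `<=` d)%fset.
  by rewrite /d -fsetUA fsubsetUl.
have le2 : (msupp b' `<=` d)%fset.
  by rewrite /d [X in (X `|` _)%fset]fsetUC -fsetUA fsubsetUl.
have le3 : (msupp (k *: b + b') `<=` d)%fset by rewrite /d fsubsetUr.
rewrite (sgmulEw (fsubset_refl _) le1) (sgmulEw (fsubset_refl _) le2).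
rewrite (sgmulEw (fsubset_refl _) le3) scaler_sumr -big_split /=.
apply/eq_bigr => u _; rewrite scaler_sumr -big_split /=.
apply/eq_bigr => v _; apply/malgP => w.
by rewrite !(mcoeffD, mcoeffZ, mcoeffU) mulrDr mulrnDl mulrCA mulrnAr.
Qed.

HB.instance Definition _ := bilinear_isBilinear.Build K
  {malg K[S]} {malg K[S]} {malg K[S]} *:%R *:%R sgmul
  (sgmul_linearl, sgmul_linearr).

Fact sgmulA : associative sgmul.
Proof.
suff bilinA (f : {bilinear {malg K[S]} -> {malg K[S]} -> {malg K[S]}}) :
    (forall x y u v, f << x *g u >> << y *g v >> = << x * y *g (u * v)%g >>) ->
  associative f by exact: (bilinA sgmul sgmulUU).
move=> fUU a b c.
rewrite [a]monalgE 3!linear_sumlz; apply/eq_bigr => u _.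
rewrite [b]monalgE linear_sumlz 2!linear_sumr linear_sumlz.
apply/eq_bigr => v _.
rewrite [c]monalgE 3!linear_sumr; apply/eq_bigr => w _.
by rewrite !fUU mulrA mulgA.
Qed.

End SemigroupAlgebra.

Notation "{ 'free_nalg' K [ X ] }" := {malg K[word X]}
  (at level 0, K, X at level 2, format "{ 'free_nalg'  K [ X ] }") : type_scope.

Section Compatibility.
Context (K : fieldType) (A : lmodType K).
Implicit Types (dot star : A -> A -> A).

Definition matching12 dot star : Prop := forall a b c : A,
  dot (star a b) c = dot a (star b c) /\ star (dot a b) c = star a (dot b c).

Definition interchangeable dot star : Prop := forall a b c : A,
  dot (star a b) c = star (dot a b) c /\ star a (dot b c) = dot a (star b c).

Definition totally_compatible dot star : Prop := forall a b c : A,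
  [/\ dot (star a b) c = star (dot a b) c,
      star (dot a b) c = star a (dot b c)
    & star a (dot b c) = dot a (star b c)].

Definition in_centroid dot (phi : {linear A -> A}) : Prop := forall x y : A,
  dot x (phi y) = phi (dot x y) /\ phi (dot x y) = dot (phi x) y.

End Compatibility.

(* Main.v *)
Require Import Defs.
From HB Require Import structures.
From mathcomp Require Import all_boot all_algebra.
From mathcomp Require Import finmap monalg.

Set Implicit Arguments.
Unset Strict Implicit.
Unset Printing Implicit Defensive.

Import GRing.Theory.
Local Open Scope ring_scope.

(** Write [a.b] for the product of the free algebra and [a*b] for [star a b].
    Each of the matching and interchange identities implies the single identity
      [(a*b).(c.d) = (a.b).(c*d)],
    and this identity alone forces [a*b] to be a fixed scalar multiple of
    [a.b]; for such a product all four conditions are immediate.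

    The rigidity is read off on words [u, v, s, t].  Multiplication by a word
    permits cancellation, so a word [w] of the support of [u*v] gives a word
    [wst] of the support of [(u*v).(st) = (uv).(s*t)]; hence [wst] begins with
    [uv] for every choice of [s] and [t].  As there are two letters, the first
    letter of [s] can be chosen so as to disagree with the letter of [uv] in
    that position if [w] is shorter than [uv]; so [w = uvr] for some possibly
    empty [r] ([support_prefix]).  Cancelling [uv] puts [rst] into the support
    of [s*t], so by the same argument [rst] begins with [st], whatever [s] is;
    as [s] may begin with a letter other than the first one of [r], the word
    [r] is empty ([support_word]).  Thus [u*v] is a multiple of [uv], and
    comparing the coefficients of [uvst] in the identity shows that the
    multiple does not depend on [u] and [v] ([star_proportional]). *)

Section BasisMultiplication.
Context (K : fieldType) (S : semigroupType).
Implicit Types (a b : {malg K[S]}) (u v w : S).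

Lemma sgmulrU a v :
  sgmul a << v >> = \sum_(u <- msupp a) << a@_u *g (u * v)%g >>.
Proof.
rewrite (sgmulEw (fsubset_refl _) msuppU_le); apply: eq_bigr => u _.
by rewrite big_seq_fset1 mcoeffUU mulr1.
Qed.

Lemma sgmulUr u b :
  sgmul << u >> b = \sum_(v <- msupp b) << b@_v *g (u * v)%g >>.
Proof.
rewrite (sgmulEw msuppU_le (fsubset_refl _)) big_seq_fset1.
by apply: eq_bigr => v _; rewrite mcoeffUU mul1r.
Qed.

(** The coefficients of an element are carried along by any injective
    relabelling of the basis; translations by an element of a cancellative
    semigroup are the instances of interest. *)
Lemma mcoeff_sum_inj (f : S -> S) a u : injective f ->
  (\sum_(v <- msupp a) << a@_v *g f v >>)@_(f u) = a@_u.
Proof.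
move=> f_inj; rewrite [in RHS](monalgE a) !raddf_sum /=; apply: eq_bigr => v _.
by rewrite !mcoeffU (inj_eq f_inj).
Qed.

Lemma mcoeff_sgmulrU a u v : injective (fun w => (w * v)%g) ->
  (sgmul a << v >>)@_(u * v)%g = a@_u.
Proof. by move=> v_inj; rewrite sgmulrU (mcoeff_sum_inj _ _ v_inj). Qed.

Lemma mcoeff_sgmulUr u v b : injective (fun w => (u * w)%g) ->
  (sgmul << u >> b)@_(u * v)%g = b@_v.
Proof. by move=> u_inj; rewrite sgmulUr (mcoeff_sum_inj _ _ u_inj). Qed.

Lemma mcoeff_sgmulUr_neq0 u b w :
  (sgmul << u >> b)@_w != 0 -> exists v, w = (u * v)%g.
Proof.
rewrite sgmulUr raddf_sum /= => sum_neq0.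
have [/hasP[v _ /eqP <-]|/hasPn no_v] :=
  boolP (has (fun v => (u * v)%g == w) (msupp b)); first by exists v.
case/eqP: sum_neq0; apply: big1_seq => v /andP[_ /no_v /negPf ne].
by rewrite mcoeffU ne mulr0n.
Qed.

(** Both sides are bilinear, so it suffices to compare them on a basis. *)
Lemma scaled_sgmul_eq (f : {bilinear {malg K[S]} -> {malg K[S]} -> {malg K[S]}})
    (k : K) :
    (forall u v, f << u >> << v >> = k *: << (u * v)%g >>) ->
  forall a b, f a b = k *: sgmul a b.
Proof.
move=> fU a b; have UE x (u : S) : << x *g u >> = x *: << u >> :> {malg K[S]}.
  by apply/malgP => w; rewrite mcoeffZ !mcoeffU mulrnAr mulr1.
rewrite [a]monalgE 2!linear_sumlz scaler_sumr; apply: eq_bigr => u _.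
rewrite [b]monalgE 2!linear_sumr scaler_sumr; apply: eq_bigr => v _.
rewrite /= sgmulUU (UE (a@_u)) (UE (b@_v)) (UE (_ * _)).
by rewrite linearZl_LR linearZr_LR /= fU !scalerA mulrC mulrA.
Qed.

End BasisMultiplication.

Section Words.
Context (X : choiceType).
Implicit Types (u v w : word X).

Lemma mulIw v : injective (fun w => (w * v)%g).
Proof.
move=> w1 w2 /(congr1 (rev \o val))/eqP.
by rewrite /= !rev_cat eqseq_cat // eqxx => /eqP/(can_inj revK)/val_inj.
Qed.

Lemma mulwI u : injective (fun w => (u * w)%g).
Proof.
move=> w1 w2 /(congr1 val)/eqP.
by rewrite /= eqseq_cat // eqxx => /eqP/val_inj.
Qed.

Definition letter (x : X) : word X := @Word X [:: x] isT.

Lemma another_letter (z : X) : (exists x y : X, x != y) -> exists c, c != z.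
Proof.
case=> x [y x_neq_y]; have [x_eq_z|] := eqVneq x z; last by exists x.
by exists y; rewrite -x_eq_z eq_sym.
Qed.

End Words.

Section Rigidity.
Context (K : fieldType) (X : choiceType).
Context (two_letters : exists x y : X, x != y).
Context (star :
  {bilinear {free_nalg K[X]} -> {free_nalg K[X]} -> {free_nalg K[X]}}).
Context (star_mid : forall a b c d : {free_nalg K[X]},
  sgmul (star a b) (sgmul c d) = sgmul (sgmul a b) (star c d)).
Implicit Types (u v w s t : word X).

Lemma star_midU u v s t :
  sgmul (star << u >> << v >>) << (s * t)%g >> =
  sgmul << (u * v)%g >> (star << s >> << t >>).
Proof.
have := star_mid << u >> << v >> << s >> << t >>.
by rewrite !sgmulUU !mulr1.
Qed.

(** For a word [w] of the support of [u*v], the word [wst] lies in the support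
    of [(uv).(s*t)], hence begins with [uv]; since [s] is arbitrary and there is
    more than one letter, [uv] cannot extend beyond [w]. *)
Lemma support_prefix u v w : (star << u >> << v >>)@_w != 0 ->
  exists r : seq X, w = u ++ v ++ r :> seq X.
Proof.
move=> w_supp.
have wst s t : exists w', w ++ s ++ t = (u ++ v) ++ val w'.
  have := w_supp; rewrite -(mcoeff_sgmulrU _ _ (@mulIw _ (s * t)%g)) star_midU.
  by case/mcoeff_sgmulUr_neq0 => w' /(congr1 val) wE; exists w'.
have le_size : (size (u ++ v) <= size w)%N.
  rewrite leqNgt; apply/negP => lt_size.
  case: two_letters => x _.
  (* A letter in disagreement with the one just after the prefix [w] of [uv]. *)
  have [c /eqP[]] := another_letter (nth x (u ++ v) (size w)) two_letters.
  have [w' /(congr1 (fun q => nth x q (size w)))] := wst (letter c) (letter c).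
  by rewrite !nth_cat lt_size ltnn subnn.
exists (drop (size (u ++ v)) w); case: two_letters => x _.
have [w' /(congr1 (take (size (u ++ v))))] := wst (letter x) (letter x).
rewrite takel_cat // take_size_cat // => uvE.
by rewrite catA -[X in X ++ _]uvE cat_take_drop.
Qed.

(** If [w = uvr] with [r] non-empty, cancelling [uv] in the middle identity puts
    [rst] into the support of [s*t]; the prefix property then makes [s] begin
    with the first letter of [r], which fails for a suitable [s]. *)
Lemma support_word u v w :
  (star << u >> << v >>)@_w != 0 -> w = (u * v)%g.
Proof.
move=> w_supp; have [[|a r] wE] := support_prefix w_supp.
  by apply: val_inj; rewrite /= wE cats0.
pose ar : word X := @Word X (a :: r) isT.
have {}wE : w = (u * v * ar)%g by apply: val_inj; rewrite /= wE catA.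
have [c /eqP[]] := another_letter a two_letters; set s := letter c.
have : (star << s >> << s >>)@_(ar * (s * s))%g != 0.
  rewrite -(mcoeff_sgmulUr _ _ (@mulwI _ (u * v)%g)) -star_midU mulgA -wE.
  by rewrite mcoeff_sgmulrU //; exact: mulIw.
by case/support_prefix => r' [].
Qed.

(** Both sides are the coefficient of [uvst] in [(u*v).(st) = (uv).(s*t)]. *)
Lemma diag_coeff u v s t :
  (star << u >> << v >>)@_(u * v)%g = (star << s >> << t >>)@_(s * t)%g.
Proof.
rewrite -(mcoeff_sgmulrU _ _ (@mulIw _ (s * t)%g)) star_midU.
by rewrite mcoeff_sgmulUr //; exact: mulwI.
Qed.

Lemma star_proportional : exists k : K, forall a b, star a b = k *: sgmul a b.
Proof.
case: two_letters => x _; pose s := letter x.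
exists (star << s >> << s >>)@_(s * s)%g.
apply: scaled_sgmul_eq => u v; apply/malgP => w; rewrite mcoeffZ mcoeffU.
rewrite -(diag_coeff u v); have [<-|ne] := eqVneq; first by rewrite mulr1.
rewrite mulr0; apply/eqP; apply/negPn/negP => /support_word wE.
by rewrite wE eqxx in ne.
Qed.

End Rigidity.

Section Conditions.
Context (K : fieldType) (S : semigroupType).
Context (star : {malg K[S]} -> {malg K[S]} -> {malg K[S]}).
Local Notation dot := (@sgmul K S).

(** The star moves to the right one factor at a time:
    [(a*b).c.d = a.(b*c).d = a.b.(c*d)]. *)
Lemma matching12_mid : matching12 dot star -> forall a b c d,
  dot (star a b) (dot c d) = dot (dot a b) (star c d).
Proof.
move=> m a b c d; have [E1 _] := m a b c; have [E2 _] := m b c d.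
by rewrite sgmulA E1 -sgmulA E2 sgmulA.
Qed.

(** Both sides equal [(a.b)*(c.d)]. *)
Lemma interchangeable_mid : interchangeable dot star -> forall a b c d,
  dot (star a b) (dot c d) = dot (dot a b) (star c d).
Proof.
move=> m a b c d; have [-> _] := m a b (dot c d).
by have [_ ->] := m (dot a b) c d.
Qed.

Lemma totally_compatible_interchangeable :
  totally_compatible dot star -> interchangeable dot star.
Proof. by move=> m a b c; have [] := m a b c. Qed.

Lemma scaled_totally_compatible (k : K) :
  (forall a b, star a b = k *: dot a b) -> totally_compatible dot star.
Proof.
by move=> starE a b c; rewrite !starE linearZl_LR linearZr_LR /= sgmulA.
Qed.

Lemma scaling_in_centroid (k : K) :
  in_centroid dot (GRing.scale k : {linear {malg K[S]} -> {malg K[S]}}).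
Proof. by move=> a b; rewrite /= linearZl_LR linearZr_LR. Qed.

Lemma centroid_matching12 (phi : {linear {malg K[S]} -> {malg K[S]}}) :
    in_centroid dot phi -> (forall a b, star a b = phi (dot a b)) ->
  matching12 dot star.
Proof.
move=> phiC starE a b c; rewrite !starE sgmulA; split=> //.
by rewrite -(phiC _ c).2 (phiC a _).1 sgmulA.
Qed.

End Conditions.

Theorem proposition4p6 (K : fieldType) (X : choiceType)
    (card_X : exists x y : X, x != y)
    (star : {bilinear {free_nalg K[X]} -> {free_nalg K[X]} -> {free_nalg K[X]}})
    (starA : associative star) :
  let dot := @sgmul K (word X) in
  [<-> matching12 dot star;
       interchangeable dot star;
       totally_compatible dot star;
       exists2 phi : {linear {free_nalg K[X]} -> {free_nalg K[X]}},
         in_centroid dot phi & forall a b, star a b = phi (dot a b)].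
Proof.
move=> dot; tfae.
- move/matching12_mid/(star_proportional card_X) => [k starE].
  exact/totally_compatible_interchangeable/(scaled_totally_compatible starE).
- move/interchangeable_mid/(star_proportional card_X) => [k starE].
  exact: scaled_totally_compatible starE.
- move/totally_compatible_interchangeable/interchangeable_mid.
  case/(star_proportional card_X) => k starE.
  by exists (GRing.scale k) => //; exact: scaling_in_centroid.
- by case=> phi phiC starE; exact: centroid_matching12 phiC starE.
Qed.
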